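(* Let $\mathbb{K}$ be a field of characteristic zero, and consider the automorphisms of $\mathbb{A}^3_{\mathbb{K}}$ (with coordinates $x,y,z$) given by $$\beta=(x+y^2(y+z^2)^2,\;y+z^2,\;z),\qquad \pi=(y,x,z).$$ Then the automorphism $\theta_2=(\pi\beta)^2\,\pi\,(\pi\beta)^{-2}\in\mathrm{GA}_3(\mathbb{K})$ is not co-tame.
   Context: $\mathrm{GA}_3(\mathbb{K})$ is the group of polynomial automorphisms of $\mathbb{A}^3_{\mathbb{K}}$. An element $\phi$ is written $\phi=(H_1,H_2,H_3)$ with $H_1=(x)\phi$, $H_2=(y)\phi$, $H_3=(z)\phi\in\mathbb{K}[x,y,z]$; for a polynomial $P$ one writes $(P)\phi=P(H_1,H_2,H_3)$, and composition satisfies $(P)(\phi\psi)=((P)\phi)\psi$. $\mathrm{Aff}_3(\mathbb{K})$ is the affine subgroup (automorphisms all of whose components have degree one). The tame subgroup $\mathrm{TA}_3(\mathbb{K})$ is the subgroup generated by $\mathrm{Aff}_3(\mathbb{K})$ and the triangular automorphisms, i.e. those of the form $(u_1x_1+P_1,u_2x_2+P_2(x_1),u_3x_3+P_3(x_1,x_2))$ with $u_i\in\mathbb{K}^*$ and $P_i$ polynomials over $\mathbb{K}$ in the indicated variables, where $x_1,x_2,x_3$ denote the coordinates (since affine automorphisms include permutations of the coordinates, the ordering chosen does not affect the group generated). An automorphism $\phi\in\mathrm{GA}_3(\mathbb{K})$ is co-tame if $\mathrm{TA}_3(\mathbb{K})\subset\langle \phi,\mathrm{Aff}_3(\mathbb{K})\rangle$.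 *)

(* Defs.v *)
From HB Require Import structures.
From mathcomp Require Import all_boot all_order all_algebra.
From mathcomp Require Import mpoly.

Set Implicit Arguments.
Unset Strict Implicit.
Unset Printing Implicit Defensive.

Import GRing.Theory.
Local Open Scope ring_scope.

Section PolynomialAutomorphisms.
Variables (n : nat) (K : fieldType).

Definition endo := n.-tuple {mpoly K[n]}.

Definition endo1 : endo := [tuple 'X_i | i < n].

(* Endomorphisms act on polynomials on the right: (P)(phi psi) = ((P)phi)psi,
   so the i-th component of phi psi is the i-th component of phi with the
   components of psi substituted for the variables. *)
Definition endo_mul (phi psi : endo) : endo :=
  [tuple tnth phi i \mPo psi | i < n].

Lemma comp_endo_mul (p : {mpoly K[n]}) (phi psi : endo) :
  p \mPo endo_mul phi psi = (p \mPo phi) \mPo psi.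
Proof.
rewrite (comp_mpolyEX p phi) (comp_mpolyEX p) raddf_sum /=.
apply: eq_bigr => m _; rewrite comp_mpolyZ; congr (_ *: _).
rewrite !comp_mpolyX rmorph_prod /=.
by apply: eq_bigr => i _; rewrite rmorphXn /= tnth_mktuple.
Qed.

Lemma endo_mulA : associative endo_mul.
Proof.
by move=> p q r; apply: eq_from_tnth => i; rewrite !tnth_mktuple comp_endo_mul.
Qed.

Lemma endo_mul1 : right_id endo1 endo_mul.
Proof.
by move=> p; apply: eq_from_tnth => i; rewrite tnth_mktuple comp_mpoly_id.
Qed.

Lemma endo_1mul : left_id endo1 endo_mul.
Proof.
move=> p; apply: eq_from_tnth => i.
by rewrite !tnth_mktuple comp_mpolyXU -tnth_nth.
Qed.

(* An automorphism is stored with its (unique) inverse, so that inversion in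
   the group is computable; by [aut_inj] only the first entry matters. *)
Definition mutually_inverse (u : endo * endo) : bool :=
  (endo_mul u.1 u.2 == endo1) && (endo_mul u.2 u.1 == endo1).

Record GA := MkGA { aut_pair : endo * endo; _ : mutually_inverse aut_pair }.

HB.instance Definition _ := [isSub for aut_pair].
HB.instance Definition _ := [Choice of GA by <:].

Definition aut (phi : GA) : endo := (aut_pair phi).1.
Definition aut_inv (phi : GA) : endo := (aut_pair phi).2.

Lemma aut_mulV phi : endo_mul (aut phi) (aut_inv phi) = endo1.
Proof. by case/andP: (valP phi) => /eqP. Qed.

Lemma aut_Vmul phi : endo_mul (aut_inv phi) (aut phi) = endo1.
Proof. by case/andP: (valP phi) => _ /eqP. Qed.

Lemma aut_inj : injective aut.
Proof.
move=> phi psi eq_aut; apply: val_inj.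
suff eq_inv : aut_inv phi = aut_inv psi.
  by rewrite /= [LHS]surjective_pairing [RHS]surjective_pairing; congr pair.
rewrite -[LHS]endo_mul1 -(aut_mulV psi) endo_mulA -eq_aut aut_Vmul.
exact: endo_1mul.
Qed.

Fact GA_one_subproof : mutually_inverse (endo1, endo1).
Proof. by rewrite /mutually_inverse /= endo_mul1 eqxx. Qed.

Definition GA_one : GA := MkGA GA_one_subproof.

Fact GA_inv_subproof phi : mutually_inverse (aut_inv phi, aut phi).
Proof. by rewrite /mutually_inverse /= aut_mulV aut_Vmul eqxx. Qed.

Definition GA_inv phi : GA := MkGA (GA_inv_subproof phi).

Fact GA_mul_subproof phi psi :
  mutually_inverse (endo_mul (aut phi) (aut psi),
                    endo_mul (aut_inv psi) (aut_inv phi)).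
Proof.
rewrite /mutually_inverse /= !endo_mulA -(endo_mulA (aut phi)).
rewrite -(endo_mulA (aut_inv psi)).
by rewrite aut_mulV aut_Vmul !endo_mul1 aut_mulV aut_Vmul eqxx.
Qed.

Definition GA_mul phi psi : GA := MkGA (GA_mul_subproof phi psi).

Fact GA_mulA : associative GA_mul.
Proof. by move=> f g h; apply: aut_inj; apply: endo_mulA. Qed.
Fact GA_1mul : left_id GA_one GA_mul.
Proof. by move=> f; apply: aut_inj; apply: endo_1mul. Qed.
Fact GA_mul1 : right_id GA_one GA_mul.
Proof. by move=> f; apply: aut_inj; apply: endo_mul1. Qed.
Fact GA_Vmul : left_inverse GA_one GA_inv GA_mul.
Proof. by move=> f; apply: aut_inj; apply: aut_Vmul. Qed.
Fact GA_mulV : right_inverse GA_one GA_inv GA_mul.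
Proof. by move=> f; apply: aut_inj; apply: aut_mulV. Qed.

HB.instance Definition _ :=
  isGroup.Build GA GA_mulA GA_1mul GA_mul1 GA_Vmul GA_mulV.

(* [msize] is the total degree plus one. *)
Definition is_affine (phi : GA) : Prop :=
  forall i : 'I_n, msize (tnth (aut phi) i) = 2.

End PolynomialAutomorphisms.

Inductive gen_subgroup (G : groupType) (S : G -> Prop) : G -> Prop :=
| gen_subgroup_mem g of S g : gen_subgroup S g
| gen_subgroup1 : gen_subgroup S 1%g
| gen_subgroupM g h of gen_subgroup S g & gen_subgroup S h : gen_subgroup S (g * h)%g
| gen_subgroupV g of gen_subgroup S g : gen_subgroup S g^-1%g.

Section DimensionThree.
Variable K : fieldType.

Definition varX : {mpoly K[3]} := 'X_(@Ordinal 3 0 isT).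
Definition varY : {mpoly K[3]} := 'X_(@Ordinal 3 1 isT).
Definition varZ : {mpoly K[3]} := 'X_(@Ordinal 3 2 isT).

Definition is_triangular (phi : GA 3 K) : Prop :=
  exists (u1 u2 u3 : K) (P1 : K) (P2 : {mpoly K[1]}) (P3 : {mpoly K[2]}),
    [/\ u1 != 0, u2 != 0, u3 != 0
      & aut phi = [tuple u1 *: varX + P1%:MP;
                         u2 *: varY + (P2 \mPo [tuple varX]);
                         u3 *: varZ + (P3 \mPo [tuple varX; varY])]].

Definition is_tame : GA 3 K -> Prop :=
  gen_subgroup (fun phi : GA 3 K => is_affine phi \/ is_triangular phi).

Definition co_tame (phi : GA 3 K) : Prop :=
  forall psi : GA 3 K, is_tame psi ->
    gen_subgroup (fun rho : GA 3 K => rho = phi \/ is_affine rho) psi.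

Definition beta_endo : endo 3 K :=
  [tuple varX + varY ^+ 2 * (varY + varZ ^+ 2) ^+ 2; varY + varZ ^+ 2; varZ].

Definition beta_inv_endo : endo 3 K :=
  [tuple varX - (varY - varZ ^+ 2) ^+ 2 * varY ^+ 2; varY - varZ ^+ 2; varZ].

Definition pi_endo : endo 3 K := [tuple varY; varX; varZ].

Lemma comp_X (phi : endo 3 K) : varX \mPo phi = tnth phi (@Ordinal 3 0 isT).
Proof. by rewrite comp_mpolyXU -tnth_nth. Qed.

Lemma comp_Y (phi : endo 3 K) : varY \mPo phi = tnth phi (@Ordinal 3 1 isT).
Proof. by rewrite comp_mpolyXU -tnth_nth. Qed.

Lemma comp_Z (phi : endo 3 K) : varZ \mPo phi = tnth phi (@Ordinal 3 2 isT).
Proof. by rewrite comp_mpolyXU -tnth_nth. Qed.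

Lemma endo3_eq (phi psi : endo 3 K) :
  tnth phi (@Ordinal 3 0 isT) = tnth psi (@Ordinal 3 0 isT) ->
  tnth phi (@Ordinal 3 1 isT) = tnth psi (@Ordinal 3 1 isT) ->
  tnth phi (@Ordinal 3 2 isT) = tnth psi (@Ordinal 3 2 isT) -> phi = psi.
Proof.
move=> e0 e1 e2; apply: eq_from_tnth => -[[|[|[|//]]] lt_i3].
- by rewrite (_ : Ordinal _ = @Ordinal 3 0 isT) //; apply: val_inj.
- by rewrite (_ : Ordinal _ = @Ordinal 3 1 isT) //; apply: val_inj.
- by rewrite (_ : Ordinal _ = @Ordinal 3 2 isT) //; apply: val_inj.
Qed.

Fact beta_subproof : mutually_inverse (beta_endo, beta_inv_endo).
Proof.
have compE := (comp_X, comp_Y, comp_Z).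
apply/andP; split; apply/eqP; apply: endo3_eq; rewrite !tnth_mktuple;
  rewrite !(tnth_nth 0) /= ?(rmorphD, rmorphN, rmorphM, rmorphXn) /=;
  by rewrite ?compE !(tnth_nth 0) /= ?subrK ?addrK.
Qed.

Fact pi_subproof : mutually_inverse (pi_endo, pi_endo).
Proof.
apply/andP; split; apply/eqP; apply: endo3_eq; rewrite !tnth_mktuple;
  by rewrite !(tnth_nth 0) /= ?(comp_X, comp_Y, comp_Z) !(tnth_nth 0).
Qed.

Definition beta_aut : GA 3 K := MkGA beta_subproof.
Definition pi_aut : GA 3 K := MkGA pi_subproof.

Definition theta2 : GA 3 K := ((pi_aut * beta_aut) ^+ 2 * pi_aut * (pi_aut * beta_aut) ^- 2)%g.

End DimensionThree.

(* Main.v *)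
Require Import Defs.
From mathcomp Require Import all_boot all_order all_algebra.
From mathcomp Require Import mpoly ring zify.
(** Left multiplication acts on triples of polynomials (P, Q, R).  Write
    sigma = pi beta and tau = pi beta^-1: they send (P, Q, R) to
    (Q ± R^2, P ± Q^2 (Q ± R^2)^2, R), and theta_2 = sigma^2 tau^2 pi.  If
    3 deg R < deg Q and deg P < deg Q, both maps preserve these inequalities
    and quadruple deg Q.  The affine maps that can destroy this growth between
    two occurrences of theta_2 are triangular, and commuting them past
    beta^-1 _ beta twice leaves only the diagonal maps (c^2 x, c^2 y, c z) with
    c^8 = c^2, which commute with theta_2.  Since theta_2 is an involution,
    every element of the group generated by theta_2 and the affine maps is
    either affine or a word theta_2 a_1 theta_2 ... theta_2 a_n, up to an affine
    factor, without such diagonal a_i inside; the latter has degree at least 16,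
    so that the quadratic map (x, y + x^2, z) is not in the group. *)

Set Implicit Arguments.
Unset Strict Implicit.
Unset Printing Implicit Defensive.
Import GRing.Theory.
Local Open Scope ring_scope.

(** * Degree calculus for multivariate polynomials *)

Section Degree.
Variables (n : nat) (K : fieldType).
Implicit Types (p q : {mpoly K[n]}) (c : K) (d e : nat).

Definition has_degree p d := msize p = d.+1.

(* Degree strictly below [d]; the zero polynomial has degree below 0. *)
Definition degree_lt p d := (msize p <= d)%N.

Lemma has_degree_neq0 p d : has_degree p d -> p != 0.
Proof. by rewrite -msize_poly_eq0 => ->. Qed.

Lemma has_degree_lt p d e : has_degree p d -> (d < e)%N -> degree_lt p e.
Proof. by rewrite /degree_lt => ->. Qed.

Lemma degree_ltW p d e : degree_lt p d -> (d <= e)%N -> degree_lt p e.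
Proof. exact: leq_trans. Qed.

Lemma degree_ltC c d : (0 < d)%N -> degree_lt c%:MP d.
Proof. by rewrite /degree_lt msizeC; case: (c == 0). Qed.

Lemma degree_ltN p d : degree_lt p d -> degree_lt (- p) d.
Proof. by rewrite /degree_lt msizeN. Qed.

Lemma degree_ltD p q d : degree_lt p d -> degree_lt q d -> degree_lt (p + q) d.
Proof.
by rewrite /degree_lt => ? ?; rewrite (leq_trans (msizeD_le _ _))// geq_max; apply/andP.
Qed.

(** The bound on [q] is shifted to read deg q at most e, so that only one factor has to be
    strict. *)
Lemma degree_ltM p q d e :
  degree_lt p d -> degree_lt q e.+1 -> degree_lt (p * q) (d + e).
Proof.
rewrite /degree_lt; have [->|p0] := eqVneq p 0; first by rewrite mul0r msize0.
have [->|q0] := eqVneq q 0; first by rewrite mulr0 msize0.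
rewrite msizeM//; move: (msize p) (msize q) => i j; lia.
Qed.

Lemma degree_ltCM c p d : degree_lt p d -> degree_lt (c%:MP * p) d.
Proof. by rewrite mul_mpolyC; apply/leq_trans/msizeZ_le. Qed.

Lemma has_degreeC c : c != 0 -> has_degree c%:MP 0.
Proof. by rewrite /has_degree msizeC => ->. Qed.

Lemma has_degreeN p d : has_degree p d -> has_degree (- p) d.
Proof. by rewrite /has_degree msizeN. Qed.

Lemma has_degreeM p q d e :
  has_degree p d -> has_degree q e -> has_degree (p * q) (d + e).
Proof.
move=> hp hq; rewrite /has_degree msizeM ?(has_degree_neq0 hp)//.
  by rewrite hp hq addSn addnS.
exact: has_degree_neq0 hq.
Qed.

Lemma has_degreeX2 p d : has_degree p d -> has_degree (p ^+ 2) (d + d).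
Proof. by rewrite expr2 => hp; apply: has_degreeM. Qed.

Lemma has_degreeCM c p d : c != 0 -> has_degree p d -> has_degree (c%:MP * p) d.
Proof. by move=> c0 hp; rewrite -[d]add0n; apply: has_degreeM hp; apply: has_degreeC. Qed.

Lemma has_degreeDl p q d :
  has_degree p d -> degree_lt q d -> has_degree (p + q) d.
Proof.
move=> hp hq; have lt_p : degree_lt (p + q) d.+1.
  by apply: degree_ltD; [apply: has_degree_lt hp _|apply: degree_ltW hq _].
apply/eqP; rewrite eqn_leq [X in X && _]lt_p ltnNge; apply/negP => lt_pq.
have: degree_lt p d by rewrite -(addrK q p); apply/degree_ltD/degree_ltN.
by rewrite /degree_lt hp ltnn.
Qed.

Lemma has_degreeDr p q d :
  degree_lt p d -> has_degree q d -> has_degree (p + q) d.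
Proof. by move=> hp hq; rewrite addrC; apply: has_degreeDl. Qed.

End Degree.

(** * Cancellation when a triangular affine map stands between beta and its inverse *)

Section TriangularConjugation.
Variables (n : nat) (K : fieldType).
Hypothesis two_neq0 : (2%:R : K) != 0.
Implicit Types (P Q R : {mpoly K[n]}).

Lemma degree_lt_quadratic (R : {mpoly K[n]}) r (a b c : K) :
  has_degree R r -> degree_lt (a%:MP * R ^+ 2 + b%:MP * R + c%:MP) (r + r).+1.
Proof.
move=> hR; apply: degree_ltD _ (degree_ltC _ _ _) => //; apply: degree_ltD.
  by apply/degree_ltCM/(has_degree_lt (has_degreeX2 hR)); lia.
by apply/degree_ltCM/(has_degree_lt hR); lia.
Qed.

Lemma degree_lt_linear (R : {mpoly K[n]}) r (b c : K) :
  has_degree R r -> degree_lt (b%:MP * R + c%:MP) r.+1.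
Proof.
move=> hR; apply: degree_ltD _ (degree_ltC _ _ _) => //.
by apply/degree_ltCM/(has_degree_lt hR); lia.
Qed.

Lemma has_degree_linear (R : {mpoly K[n]}) r (b c : K) :
  (0 < r)%N -> b != 0 -> has_degree R r -> has_degree (b%:MP * R + c%:MP) r.
Proof. by move=> r0 b0 hR; apply: has_degreeDl _ (degree_ltC _ _ r0); apply: has_degreeCM. Qed.

Lemma has_degree_quadratic (R : {mpoly K[n]}) r (a b c : K) :
  (0 < r)%N -> a != 0 -> has_degree R r ->
  has_degree (a%:MP * R ^+ 2 + b%:MP * R + c%:MP) (r + r).
Proof.
move=> r0 a0 hR; rewrite -addrA; apply: has_degreeDl.
  by apply: has_degreeCM a0 (has_degreeX2 hR).
by apply: degree_ltW (degree_lt_linear _ _ hR) _; lia.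
Qed.

(** The weights for which beta is homogeneous: if R scales by c, then Q + R^2 forces c^2 on Q, and P
    + Q^2 (Q + R^2)^2 forces c^8 on P. The coefficients of R and 1 in the first row stay free. *)
Definition quasi_homothety (a b k c k3 d e : K) :=
  [/\ a = c ^+ 2, d = c ^+ 8, b = 0, k = 0 & k3 = 0 /\ e = 0].

(* [V], [W], [S] are the components of (d x + e y + z w + k1, a y + b w + k, c w + k3)
   beta applied to (P, Q, R); a further beta^-1 can cancel the degree 4q part of
   the first one only if the affine map is a [quasi_homothety]. *)
Lemma degrees_untwist_triangular P Q R q r (a b k c k3 d e z k1 : K)
    (W := a%:MP * (Q + R ^+ 2) + b%:MP * R + k%:MP)
    (S := c%:MP * R + k3%:MP)
    (V := d%:MP * (P + Q ^+ 2 * (Q + R ^+ 2) ^+ 2) +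
          e%:MP * (Q + R ^+ 2) + z%:MP * R + k1%:MP) :
  degree_lt P q -> has_degree Q q -> has_degree R r -> (3 * r < q)%N -> (0 < r)%N ->
  a != 0 -> c != 0 ->
  [/\ has_degree (W - S ^+ 2) q, has_degree S r
    & (exists2 j, has_degree (V - W ^+ 2 * (W - S ^+ 2) ^+ 2) j
                & (q <= j)%N /\ (e = 0 -> (q < j)%N)) \/
      quasi_homothety a b k c k3 d e].
Proof.
move=> hP hQ hR lt_rq r0 a0 c0.
have hS : has_degree S r by apply: has_degree_linear.
have hQ2 : has_degree (Q + R ^+ 2) q.
  by apply: has_degreeDl hQ (has_degree_lt (has_degreeX2 hR) _); lia.
have hW : has_degree W q.
  rewrite /W -addrA; apply: has_degreeDl; first exact: has_degreeCM.
  by apply: degree_ltW (degree_lt_linear _ _ hR) _; lia.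
have hW' : has_degree (W - S ^+ 2) q.
  apply: has_degreeDl hW (degree_ltN _).
  by apply: has_degree_lt (has_degreeX2 hS) _; lia.
split=> //.
(* Factor a^4 Q^2 (Q + R^2)^2 - W^2 (W - S^2)^2 = A B as a difference of squares. *)
pose a' := a - c ^+ 2; pose l := b - 2%:R * c * k3; pose k' := k - k3 ^+ 2.
pose T := d%:MP * P + e%:MP * (Q + R ^+ 2) + z%:MP * R + k1%:MP.
(* Here W = a Q + h and W - S^2 = a Q + g, and f = g + h - a R^2 is the coefficient of - a Q left in
   A once a^2 Q^2 cancels. *)
pose g := a'%:MP * R ^+ 2 + l%:MP * R + k'%:MP.
pose f := a'%:MP * R ^+ 2 + (l + b)%:MP * R + (k' + k)%:MP.
pose h := a%:MP * R ^+ 2 + b%:MP * R + k%:MP.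
pose A := - (a%:MP * (Q * f) + g * h).
pose B := (a ^+ 2)%:MP * (Q * (Q + R ^+ 2)) + W * (W - S ^+ 2).
have defV : V - W ^+ 2 * (W - S ^+ 2) ^+ 2 =
    T + (d - a ^+ 4)%:MP * (Q ^+ 2 * (Q + R ^+ 2) ^+ 2) + A * B.
  rewrite /V /A /B /T /f /g /h /W /S /a' /l /k'. ring.
have hT : degree_lt T q.+1.
  rewrite /T; apply: degree_ltD _ (degree_ltC _ _ _) => //; apply: degree_ltD; last first.
    by apply/degree_ltCM/(has_degree_lt hR); lia.
  by apply: degree_ltD; apply/degree_ltCM; [apply: degree_ltW hP _|apply: has_degree_lt hQ2 _].
(* B is the sum of the two square roots, with leading part 2 a^2 Q^2, so any drop in degree comes
   from A. *)
have hB : has_degree B (q + q).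
  have -> : B = (2%:R * a ^+ 2)%:MP * (Q * Q) +
    (a%:MP * (Q * (a%:MP * R ^+ 2 + g + h)) + g * h).
    rewrite /B /f /g /h /W /S /a' /l /k'; ring.
  apply: has_degreeDl.
    by apply: has_degreeCM _ (has_degreeM hQ hQ); rewrite mulf_neq0 ?expf_neq0.
  apply: degree_ltD.
    apply: degree_ltCM; rewrite mulrC.
    apply: degree_ltM _ (has_degree_lt hQ _) => //.
    apply: (@degree_ltW _ _ _ (r + r).+1); last lia.
    apply: degree_ltD _ (degree_lt_quadratic _ _ _ hR).
    apply: degree_ltD _ (degree_lt_quadratic _ _ _ hR).
    by apply/degree_ltCM/(has_degree_lt (has_degreeX2 hR)); lia.
  apply: degree_ltW (degree_ltM (degree_lt_quadratic _ _ _ hR)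
    (degree_lt_quadratic _ _ _ hR)) _; lia.
have hgh : degree_lt (g * h) (4 * r).+1.
  apply: degree_ltW (degree_ltM (degree_lt_quadratic _ _ _ hR)
    (degree_lt_quadratic _ _ _ hR)) _; lia.
have [defd|d_neq] := eqVneq d (a ^+ 4); last first.
  left; exists (q + q + (q + q))%N; last by split=> [|_]; lia.
  rewrite defV -addrA; apply: has_degreeDr; first by apply: degree_ltW hT _; lia.
  apply: has_degreeDl.
    by apply: has_degreeCM; rewrite ?subr_eq0//; apply/has_degreeM; apply/has_degreeX2.
  apply: degree_ltM _ (has_degree_lt hB _) => //.
  apply/degree_ltN/degree_ltD; last by apply: degree_ltW hgh _; lia.
  apply: degree_ltCM; rewrite mulrC; apply: degree_ltM _ (has_degree_lt hQ _) => //.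
  by apply: degree_ltW (degree_lt_quadratic _ _ _ hR) _; lia.
rewrite {}defV defd subrr mpolyC0 mul0r addr0.
have degAB j : has_degree A j ->
    (exists2 j, has_degree (T + A * B) j & (q <= j)%N /\ (e = 0 -> (q < j)%N)).
  move=> hA; exists (j + (q + q))%N; last by split=> [|_]; lia.
  by apply: has_degreeDr (has_degreeM hA hB); apply: degree_ltW hT _; lia.
have degf j : has_degree f j -> degree_lt (g * h) (q + j) -> has_degree A (q + j).
  move=> hf gh; apply/has_degreeN/has_degreeDl => //.
  exact: has_degreeCM a0 (has_degreeM hQ hf).
(* As long as f is nonzero, Q f outweighs g h in A. The coefficients of f are therefore forced to
   vanish one after the other, from the top. *)
have [a'0|a'0] := eqVneq a' 0; last first.
  left; apply: (degAB (q + (r + r))%N); apply: degf; first exact: has_degree_quadratic.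
  by apply: degree_ltW hgh _; lia.
have defg : g = l%:MP * R + k'%:MP by rewrite /g a'0; ring.
have deff : f = (l + b)%:MP * R + (k' + k)%:MP by rewrite /f a'0; ring.
have {}hgh : degree_lt (g * h) (3 * r).+1.
  rewrite defg; apply: degree_ltW (degree_ltM (degree_lt_linear _ _ hR)
    (degree_lt_quadratic _ _ _ hR)) _; lia.
have [lb0|lb0] := eqVneq (l + b) 0; last first.
  left; apply: (degAB (q + r)%N); apply: degf; first by rewrite deff; apply: has_degree_linear.
  by apply: degree_ltW hgh _; lia.
(* For constant f, the product g h of degree at most 3 r competes with Q alone: this is where the
   bound 3 r < q is used in full. *)
have [kk0|kk0] := eqVneq (k' + k) 0; last first.
  left; apply: (degAB (q + 0)%N); apply: degf.
    by rewrite deff lb0 mpolyC0 mul0r add0r; apply: has_degreeC.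
  by apply: degree_ltW hgh _; lia.
have f0 : f = 0 by rewrite deff lb0 kk0; ring.
have [l0|l0] := eqVneq l 0; last first.
  left; apply: (degAB (r + (r + r))%N); rewrite /A f0 !mulr0 add0r; apply: has_degreeN.
  by apply: has_degreeM; [rewrite defg; apply: has_degree_linear|apply: has_degree_quadratic].
have b0 : b = 0 by rewrite -lb0 l0 add0r.
have k30 : k3 = 0.
  by move/eqP: l0; rewrite /l b0 sub0r oppr_eq0 !mulf_eq0 (negPf two_neq0) (negPf c0) => /eqP.
have k0 : k = 0.
  move/eqP: kk0; rewrite /k' k30 expr0n subr0 -mulr2n -mulr_natl mulf_eq0.
  by rewrite (negPf two_neq0) => /eqP.
have {}a'0 : a = c ^+ 2 by apply/eqP; rewrite -subr_eq0 -/a' a'0.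
have [e0|e0] := eqVneq e 0.
  by right; split=> //; rewrite a'0 -exprM.
(* Now A = 0 and only T is left; its term e (Q + R^2) has degree exactly q, hence the weak bound q
   <= j for nonzero e. *)
left; exists q; last by split=> // e0'; rewrite e0' eqxx in e0.
have A0 : A = 0 by rewrite /A f0 defg l0 /k' k0 k30; ring.
rewrite A0 mul0r addr0 /T -!addrA; apply: has_degreeDr; first exact: degree_ltCM.
apply: has_degreeDl; first exact: has_degreeCM.
by apply: degree_ltW (degree_lt_linear _ _ hR) _; lia.
Qed.
End TriangularConjugation.

(** * Affine automorphisms in matrix form *)

Section Affine.
Variables (n : nat) (K : fieldType).
Implicit Types (phi psi : GA n K) (p : {mpoly K[n]}).
Implicit Types (M : 'M[K]_n) (c : 'I_n -> K).

Definition affine_comp (M : 'M[K]_n) (c : 'I_n -> K) (i : 'I_n) : {mpoly K[n]} :=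
  \sum_j (M i j)%:MP * 'X_j + (c i)%:MP.

(** Unlike the degree condition [is_affine], this form passes directly to products and inverses. *)
Definition affine_map phi := exists2 M, M \in unitmx &
  exists c, forall i, tnth (aut phi) i = affine_comp M c i.

Lemma affine_comp_coeff M c i j : (affine_comp M c i)@_U_(j) = M i j.
Proof.
rewrite mcoeffD mcoeffC mnm1_eq0 mulr0 addr0 raddf_sum /= (bigD1 j) //=.
rewrite mcoeffCM mcoeffXU eqxx mulr1 big1 ?addr0 // => k nkj.
by rewrite mcoeffCM mcoeffXU (negPf nkj) mulr0.
Qed.

Lemma affine_comp_const M c i : (affine_comp M c i)@_0 = c i.
Proof.
rewrite mcoeffD mcoeffC eqxx mulr1 raddf_sum big1 ?add0r // => k _.
by rewrite /= mcoeffCM mcoeffX mnm1_eq0 mulr0.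
Qed.

Lemma affine_comp_lt M c i : degree_lt (affine_comp M c i) 2.
Proof.
apply: degree_ltD; last exact: degree_ltC.
apply: (big_ind (fun p => degree_lt p 2)) => [|p q|k _].
- by rewrite /degree_lt msize0.
- exact: degree_ltD.
- by apply: degree_ltCM; rewrite /degree_lt msizeX mdeg1.
Qed.

Lemma affine_compP M c i p : degree_lt p 2 ->
  (forall j, p@_U_(j) = M i j) -> p@_0 = c i -> p = affine_comp M c i.
Proof.
move=> hp pM pc; apply/mpolyP => m.
have [/eqP|m_n0] := eqVneq (mdeg m) 0.
  by rewrite mdeg_eq0 => /eqP ->; rewrite affine_comp_const.
have [/eqP/mdeg1P[j /eqP ->]|m_n1] := eqVneq (mdeg m) 1.
  by rewrite affine_comp_coeff.
have gt1 : (2 <= mdeg m)%N by case: (mdeg m) m_n0 m_n1 => [|[]].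
rewrite !memN_msupp_eq0 //; apply: msize_mdeg_ge; last exact: leq_trans hp _.
exact: leq_trans (affine_comp_lt _ _ _) _.
Qed.

Lemma tnth_endo_mul phi (s : endo n K) M c i :
  (forall i, tnth (aut phi) i = affine_comp M c i) ->
  tnth (endo_mul (aut phi) s) i = \sum_j (M i j)%:MP * tnth s j + (c i)%:MP.
Proof.
move=> E; rewrite tnth_mktuple E rmorphD raddf_sum /= comp_mpolyC.
congr (_ + _); apply: eq_bigr => j _.
by rewrite rmorphM /= comp_mpolyC comp_mpolyXU -tnth_nth.
Qed.

(** If v M = 0, expanding each X_i through phi phi^-1 = 1 turns the linear form sum v_i X_i into the
    constant sum v_i c_i, so v = 0. *)
Lemma affine_comp_unit phi M c :
  (forall i, tnth (aut phi) i = affine_comp M c i) -> M \in unitmx.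
Proof.
move=> E; rewrite -row_free_unit -kermx_eq0; apply/rowV0P => v /sub_kermxP vM0.
have eqC : \sum_i (v 0 i)%:MP * 'X_i = (\sum_i v 0 i * c i)%:MP :> {mpoly K[n]}.
  have -> : (\sum_i v 0 i * c i)%:MP =
      \sum_i (v 0 i)%:MP * tnth (endo_mul (aut phi) (aut_inv phi)) i.
    under [RHS]eq_bigr => i _ do rewrite (tnth_endo_mul _ _ E) mulrDr mulr_sumr.
    rewrite big_split /= exchange_big [X in _ = X + _]big1 ?add0r => [|j _].
      by rewrite raddf_sum; apply: eq_bigr => i _; rewrite /= mpolyCM.
    have := congr1 (fun N : 'rV_n => (N 0 j)%:MP * tnth (aut_inv phi) j) vM0.
    rewrite !mxE mpolyC0 mul0r raddf_sum mulr_suml /= => {2}<-.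
    by apply: eq_bigr => i _; rewrite mpolyCM mulrA.
  by apply: eq_bigr => i _; rewrite aut_mulV tnth_mktuple.
apply/rowP => j; rewrite mxE.
have := congr1 (mcoeff U_(j)) eqC; rewrite mcoeffC mnm1_eq0 mulr0 raddf_sum /= => <-.
rewrite (bigD1 j) //= mcoeffCM mcoeffXU eqxx mulr1 big1 ?addr0 // => k nkj.
by rewrite mcoeffCM mcoeffXU (negPf nkj) mulr0.
Qed.

Lemma is_affine_map phi : is_affine phi -> affine_map phi.
Proof.
move=> aff; pose M : 'M[K]_n := \matrix_(i, j) (tnth (aut phi) i)@_U_(j).
have E i : tnth (aut phi) i = affine_comp M (fun i => (tnth (aut phi) i)@_0) i.
  by apply: affine_compP => [|j|//]; rewrite ?mxE // /degree_lt aff.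
exists M; first exact: affine_comp_unit E.
by exists (fun i => (tnth (aut phi) i)@_0).
Qed.

Lemma affine_map1 : affine_map (1%g : GA n K).
Proof.
exists 1%:M; first exact: unitmx1.
exists (fun=> 0) => i; rewrite tnth_mktuple /affine_comp mpolyC0 addr0 (bigD1 i) //=.
rewrite mxE eqxx mpolyC1 mul1r big1 ?addr0 // => k nki.
by rewrite mxE eq_sym (negPf nki) mpolyC0 mul0r.
Qed.

Lemma affine_mapM phi psi : affine_map phi -> affine_map psi -> affine_map (phi * psi)%g.
Proof.
case=> [M uM [c E]] [N uN [d F]]; exists (M *m N); first by rewrite unitmx_mul uM.
exists (fun i => \sum_j M i j * d j + c i) => i.
rewrite (tnth_endo_mul _ _ E) /affine_comp mpolyCD addrA; congr (_ + _).
under eq_bigr => j _ do rewrite F mulrDr mulr_sumr.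
rewrite big_split /= exchange_big; congr (_ + _).
  apply: eq_bigr => j _ /[!mxE]; rewrite raddf_sum mulr_suml.
  by apply: eq_bigr => k _; rewrite /= mpolyCM mulrA.
by rewrite raddf_sum; apply: eq_bigr => j _; rewrite /= mpolyCM.
Qed.

Lemma affine_mapV phi : affine_map phi -> affine_map phi^-1%g.
Proof.
case=> [M uM [c E]]; exists (invmx M); first by rewrite unitmx_inv.
exists (fun i => - \sum_j invmx M i j * c j) => i.
(* The identity phi phi^-1 = 1 is a linear system for the components of the inverse, solved by
   [invmx M]. *)
have X j : 'X_j - (c j)%:MP = \sum_k (M j k)%:MP * tnth (aut_inv phi) k.
  have := tnth_endo_mul (aut_inv phi) j E.
  by rewrite aut_mulV tnth_mktuple => ->; rewrite addrK.
have -> : affine_comp (invmx M) (fun i => - \sum_j invmx M i j * c j) i =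
    \sum_j (invmx M i j)%:MP * ('X_j - (c j)%:MP).
  under [RHS]eq_bigr => j _ do rewrite mulrBr.
  rewrite sumrB /affine_comp mpolyCN raddf_sum; congr (_ - _).
  by apply: eq_bigr => j _; rewrite -mpolyCM.
under eq_bigr => j _ do rewrite X mulr_sumr.
rewrite exchange_big /=.
have eq_k k : \sum_j (invmx M i j)%:MP * ((M j k)%:MP * tnth (aut_inv phi) k) =
    ((i == k)%:R : K)%:MP * tnth (aut_inv phi) k.
  have -> : (i == k)%:R = (invmx M *m M) i k by rewrite mulVmx // mxE.
  rewrite mxE raddf_sum mulr_suml.
  by apply: eq_bigr => j _; rewrite /= mulrA -mpolyCM.
under eq_bigr => k _ do rewrite eq_k.
rewrite (bigD1 i) //= eqxx mpolyC1 mul1r [X in _ = _ + X]big1 ?addr0 // => k nki.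
by rewrite eq_sym (negPf nki) mpolyC0 mul0r.
Qed.

Lemma affine_map_degree phi i : affine_map phi -> has_degree (tnth (aut phi) i) 1.
Proof.
case=> [M uM [c E]]; rewrite E; apply/eqP; rewrite eqn_leq [X in X && _]affine_comp_lt.
rewrite ltnNge; apply/negP => /msize1_polyC eqC.
suff: row i M = 0.
  move/(congr1 (mulmx^~ (invmx M))); rewrite -row_mul mulmxV // mul0mx.
  by move/rowP/(_ i); rewrite !mxE eqxx => /eqP; rewrite oner_eq0.
apply/rowP => j; rewrite !mxE -(affine_comp_coeff M c) eqC mcoeffC mnm1_eq0.
by rewrite mulr0.
Qed.
End Affine.

(** * Left multiplication by pi, beta and theta_2 *)

Section DimensionThree.
Variable K : fieldType.
Hypothesis two_neq0 : (2%:R : K) != 0.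

Notation i0 := (@Ordinal 3 0 isT).
Notation i1 := (@Ordinal 3 1 isT).
Notation i2 := (@Ordinal 3 2 isT).

Lemma tnth3E (p q r : {mpoly K[3]}) :
  (tnth [tuple p; q; r] i0 = p) * (tnth [tuple p; q; r] i1 = q) *
  (tnth [tuple p; q; r] i2 = r).
Proof. by []. Qed.

Definition compE := (comp_mpolyC, comp_X, comp_Y, comp_Z).

Definition twist (s : endo 3 K) : endo 3 K :=
  [tuple tnth s i1 + tnth s i2 ^+ 2;
         tnth s i0 + tnth s i1 ^+ 2 * (tnth s i1 + tnth s i2 ^+ 2) ^+ 2;
         tnth s i2].

(* Not the inverse of [twist]: [twist] is left multiplication by pi beta, [untwist] by
   pi beta^-1. *)
Definition untwist (s : endo 3 K) : endo 3 K :=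
  [tuple tnth s i1 - tnth s i2 ^+ 2;
         tnth s i0 - tnth s i1 ^+ 2 * (tnth s i1 - tnth s i2 ^+ 2) ^+ 2;
         tnth s i2].

Definition swap (s : endo 3 K) : endo 3 K := [tuple tnth s i1; tnth s i0; tnth s i2].

Lemma endo_mul_pi s : endo_mul (aut (pi_aut K)) s = swap s.
Proof.
by apply: endo3_eq; rewrite tnth_mktuple -[aut _]/(pi_endo K) /swap !tnth3E compE.
Qed.

Lemma endo_mul_beta s : endo_mul (aut (beta_aut K)) s = swap (twist s).
Proof.
apply: endo3_eq; rewrite tnth_mktuple -[aut _]/(beta_endo K) /swap /twist !tnth3E.
- by rewrite rmorphD rmorphM !rmorphXn rmorphD rmorphXn /= !compE.
- by rewrite rmorphD rmorphXn /= !compE.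
- by rewrite compE.
Qed.

Lemma endo_mul_betaV s : endo_mul (aut (beta_aut K)^-1%g) s = swap (untwist s).
Proof.
apply: endo3_eq; rewrite tnth_mktuple -[aut _]/(beta_inv_endo K) /swap /untwist !tnth3E.
- by rewrite rmorphB rmorphM !rmorphXn rmorphB rmorphXn /= !compE mulrC.
- by rewrite rmorphB rmorphXn /= !compE.
- by rewrite compE.
Qed.

Lemma swapK : involutive swap.
Proof. by move=> s; apply: endo3_eq; rewrite /swap !tnth3E. Qed.

Lemma endo_mul_autM (g h : GA 3 K) s :
  endo_mul (aut (g * h)%g) s = endo_mul (aut g) (endo_mul (aut h) s).
Proof. exact/esym/endo_mulA. Qed.

(** Regrouping pi (beta^-1 pi)^2 as (pi beta^-1)^2 pi leaves a single [swap], applied first. *)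
Lemma endo_mul_theta2 s : endo_mul (aut (theta2 K)) s =
  twist (twist (untwist (untwist (swap s)))).
Proof.
have piV : ((pi_aut K)^-1 = pi_aut K)%g by exact: aut_inj.
rewrite /theta2 !expgS expg0 mulg1 !invgM piV !endo_mul_autM.
by rewrite !(endo_mul_pi, endo_mul_betaV, endo_mul_beta) !swapK.
Qed.

(** * Degree growth under [twist] and [untwist] *)

Definition dominated (s : endo 3 K) := exists q r,
  [/\ degree_lt (tnth s i0) q, has_degree (tnth s i1) q, has_degree (tnth s i2) r
    & (3 * r < q)%N /\ (0 < r)%N].

Lemma twist_degrees s : dominated s -> exists q r,
  [/\ has_degree (tnth (twist s) i0) q, has_degree (tnth (twist s) i1) (4 * q),
      has_degree (tnth (twist s) i2) r & (3 * r < q)%N /\ (0 < r)%N].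
Proof.
move=> [q [r [hP hQ hR [lt_rq r0]]]]; exists q, r; split=> //; rewrite /twist !tnth3E //.
  by apply: has_degreeDl hQ (has_degree_lt (has_degreeX2 hR) _); lia.
apply: has_degreeDr; first by apply: degree_ltW hP _; lia.
have -> : (4 * q = q + q + (q + q))%N by lia.
apply: has_degreeM; first exact: has_degreeX2.
apply: has_degreeX2.
by apply: has_degreeDl hQ (has_degree_lt (has_degreeX2 hR) _); lia.
Qed.

Lemma dominated_twist s : dominated s -> dominated (twist s).
Proof.
move=> /twist_degrees[q [r [h0 h1 h2 [lt_rq r0]]]]; exists (4 * q)%N, r; split=> //.
  by apply: has_degree_lt h0 _; lia.
by lia.
Qed.

(** The alternatives tell which of Q and R^2 dominates Q - R^2; for q = 2 r leading terms could
    cancel. The bound on p keeps P below Q^2 (Q - R^2)^2. *)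
Lemma dominated_untwist s p q r :
  degree_lt (tnth s i0) p -> has_degree (tnth s i1) q -> has_degree (tnth s i2) r ->
  (0 < r)%N -> (2 * r < q /\ p <= 4 * q \/ q < 2 * r /\ p <= 2 * q + 4 * r)%N ->
  dominated (untwist s).
Proof.
move=> hP hQ hR r0 [[lt_rq le_p]|[lt_qr le_p]].
- have hQ' : has_degree (tnth s i1 - tnth s i2 ^+ 2) q.
    apply: has_degreeDl hQ (degree_ltN _).
    by apply: has_degree_lt (has_degreeX2 hR) _; lia.
  exists (4 * q)%N, r; split; rewrite /untwist ?tnth3E //; last lia.
    by apply: has_degree_lt hQ' _; lia.
  apply: has_degreeDr; first exact: degree_ltW hP _.
  have -> : (4 * q = q + q + (q + q))%N by lia.
  exact/has_degreeN/has_degreeM/has_degreeX2/hQ'/has_degreeX2.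
- have hQ' : has_degree (tnth s i1 - tnth s i2 ^+ 2) (r + r).
    apply: has_degreeDr; first by apply: has_degree_lt hQ _; lia.
    exact/has_degreeN/has_degreeX2.
  exists (2 * q + 4 * r)%N, r; split; rewrite /untwist ?tnth3E //; last lia.
    by apply: has_degree_lt hQ' _; lia.
  apply: has_degreeDr; first exact: degree_ltW hP _.
  have -> : (2 * q + 4 * r = q + q + (r + r + (r + r)))%N by lia.
  exact/has_degreeN/has_degreeM/has_degreeX2/hQ'/has_degreeX2.
Qed.

Lemma dominated_untwist2 s : dominated s -> dominated (untwist s).
Proof.
by move=> [q [r [hP hQ hR [lt_rq r0]]]]; apply: dominated_untwist hP hQ hR r0 _; lia.
Qed.

(** * Diagonal maps commuting with theta_2 *)

Definition stable_diagonal (a : GA 3 K) : bool :=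
  let c := (tnth (aut a) i2)@_U_(i2) in
  (c ^+ 8 == c ^+ 2) &&
  (aut a == [tuple c%:MP ^+ 2 * varX K; c%:MP ^+ 2 * varY K; c%:MP * varZ K]).

(** Equal weights on x and y give commutation with pi; c^8 = c^2 makes beta homogeneous for the
    weights c^2, c^2, c. Since theta_2 is a word in pi and beta, it commutes too. *)
Lemma stable_diagonal_commute a : stable_diagonal a -> (theta2 K * a = a * theta2 K)%g.
Proof.
case/andP=> /eqP c8 /eqP; set c := _@__ in c8 * => defa.
have aE s : endo_mul (aut a) s =
    [tuple c%:MP ^+ 2 * tnth s i0; c%:MP ^+ 2 * tnth s i1; c%:MP * tnth s i2].
  rewrite defa; apply: endo3_eq; rewrite tnth_mktuple !tnth3E rmorphM ?rmorphXn /=;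
  by rewrite !compE.
have cpi : commute (pi_aut K) a.
  apply: aut_inj; rewrite [LHS]endo_mul_pi [RHS]aE defa.
  by apply: endo3_eq; rewrite /swap !tnth3E.
have c8P : c%:MP ^+ 8 = c%:MP ^+ 2 :> {mpoly K[3]} by rewrite -!rmorphXn /= c8.
have cbeta : commute (beta_aut K) a.
  apply: aut_inj; rewrite [LHS]endo_mul_beta [RHS]aE defa.
  apply: endo3_eq; rewrite -[aut _]/(beta_endo K) /swap /twist !tnth3E; [|ring|by []].
  rewrite [RHS]mulrDr -[X in _ = _ + X * _]c8P; ring.
have cs : commute a (pi_aut K * beta_aut K)%g.
  by apply: commuteM; apply: commute_sym.
apply/commute_sym/commuteM; last exact/commuteV/commuteX.
by apply: commuteM; [apply: commuteX|apply: commute_sym].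
Qed.

Lemma conj_involution (G : groupType) (u p : G) :
  (p * p = 1 -> (u * p / u) * (u * p / u) = 1)%g.
Proof. by move=> pp; rewrite -!mulgA mulKg (mulgA p) pp mul1g mulgV. Qed.

Lemma theta2_invol : (theta2 K * theta2 K = 1)%g.
Proof.
have pi2 : (pi_aut K * pi_aut K = 1)%g.
  by apply: aut_inj; rewrite [LHS]endo_mul_pi; apply: endo3_eq; rewrite tnth_mktuple.
exact: conj_involution.
Qed.

Lemma theta2K (g : GA 3 K) : (theta2 K * (theta2 K * g) = g)%g.
Proof. by rewrite (mulgA (theta2 K)) theta2_invol mul1g. Qed.

(** * Affine maps between two occurrences of theta_2 *)

Lemma affine_endo_mul (a : GA 3 K) M c s i :
  (forall i, tnth (aut a) i = affine_comp M c i) ->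
  tnth (endo_mul (aut a) s) i =
  (M i i0)%:MP * tnth s i0 + (M i i1)%:MP * tnth s i1 + (M i i2)%:MP * tnth s i2
    + (c i)%:MP.
Proof.
have e0 : ord0 = i0 by exact: val_inj.
have e1 : lift ord0 ord0 = i1 by exact: val_inj.
have e2 : lift ord0 (lift ord0 ord0) = i2 by exact: val_inj.
move=> E; rewrite (tnth_endo_mul _ _ E) !big_ord_recl big_ord0 addr0 !addrA.
by rewrite e2 e1 e0.
Qed.

(** The degrees r < m < 4 m are distinct, so the largest one with a nonzero coefficient wins. *)
Lemma degree_affine_row (s : endo 3 K) m r (a b c k : K) :
  has_degree (tnth s i0) m -> has_degree (tnth s i1) (4 * m) ->
  has_degree (tnth s i2) r -> (3 * r < m)%N -> (0 < r)%N ->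
  [|| b != 0, a != 0 | c != 0] ->
  has_degree (a%:MP * tnth s i0 + b%:MP * tnth s i1 + c%:MP * tnth s i2 + k%:MP)
    (if b != 0 then (4 * m)%N else if a != 0 then m else r).
Proof.
move=> h0 h1 h2 lt_rm r0; have [->|b0 _] := eqVneq b 0; last first.
  apply: has_degreeDl; last by apply: degree_ltC; lia.
  apply: has_degreeDl; last by apply/degree_ltCM/(has_degree_lt h2); lia.
  apply: has_degreeDr; first by apply/degree_ltCM/(has_degree_lt h0); lia.
  exact: has_degreeCM.
rewrite mpolyC0 mul0r addr0 /=; have [->|a0 _] := eqVneq a 0; last first.
  apply: has_degreeDl; last by apply: degree_ltC; lia.
  apply: has_degreeDl; last by apply/degree_ltCM/(has_degree_lt h2); lia.
  exact: has_degreeCM.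
by rewrite mpolyC0 mul0r add0r /= => c0; apply: has_degree_linear.
Qed.

Lemma ord3P (i : 'I_3) : [\/ i = i0, i = i1 | i = i2].
Proof.
by case: i => -[|[|[|//]]] lt_i3; [apply: Or31|apply: Or32|apply: Or33]; apply: val_inj.
Qed.

Lemma unitmx3_row_neq0 (M : 'M[K]_3) i : M \in unitmx ->
  [|| M i i1 != 0, M i i0 != 0 | M i i2 != 0].
Proof.
move=> uM; apply: contraT; rewrite !negb_or !negbK => /and3P[/eqP M1 /eqP M0 /eqP M2].
have : row i M = 0 by apply/rowP => j; rewrite !mxE; case: (ord3P j) => ->.
rewrite rowE => /(congr1 (mulmx^~ (invmx M))); rewrite mulmxK // mul0mx => /rowP/(_ i).
by rewrite !mxE !eqxx => /eqP; rewrite oner_eq0.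
Qed.

(** Otherwise rows 0 and 2 are both supported on the last column, hence dependent. This excludes
    degree r in both of the components that [untwist] compares. *)
Lemma unitmx3_block (M : 'M[K]_3) : M \in unitmx ->
  [|| M i0 i1 != 0, M i0 i0 != 0, M i2 i1 != 0 | M i2 i0 != 0].
Proof.
move=> uM; apply: contraT; rewrite !negb_or !negbK.
case/and4P=> /eqP M01 /eqP M00 /eqP M21 /eqP M20.
have := unitmx3_row_neq0 i2 uM; rewrite M20 M21 eqxx /= => M22.
have : (M i2 i2 *: delta_mx 0 i0 - M i0 i2 *: delta_mx 0 i2 : 'rV_3) *m M = 0.
  rewrite mulmxBl -!scalemxAl -!rowE; apply/rowP => j; rewrite !mxE.
  by case: (ord3P j) => ->; rewrite ?M00 ?M01 ?M20 ?M21 ?mulr0 ?subr0 // mulrC subrr.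
move/(congr1 (mulmx^~ (invmx M))); rewrite mulmxK // mul0mx => /rowP/(_ i0).
by rewrite !mxE /= mulr1 mulr0 subr0 => /eqP; rewrite (negPf M22).
Qed.

Lemma dominated_affine t a : dominated t -> affine_map a -> ~~ stable_diagonal a ->
  dominated (untwist (untwist (swap (endo_mul (aut a) (twist (twist t)))))).
Proof.
move=> dt [M uM [c E]] ndiag.
have ds := dominated_twist dt; set s := twist t in ds *.
have [m [r [h0 h1 h2 [lt_rm r0]]]] := twist_degrees ds; set u := twist s in h0 h1 h2 *.
set v := swap (endo_mul (aut a) u).
have v0 : tnth v i0 = _ := affine_endo_mul u i1 E.
have v1 : tnth v i1 = _ := affine_endo_mul u i0 E.
have v2 : tnth v i2 = _ := affine_endo_mul u i2 E.
have row_neq0 i := unitmx3_row_neq0 i uM.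
have := degree_affine_row (c i0) h0 h1 h2 lt_rm r0 (row_neq0 i0); rewrite -v1 => d1.
have := degree_affine_row (c i2) h0 h1 h2 lt_rm r0 (row_neq0 i2); rewrite -v2 => d2.
have d0 : degree_lt (tnth v i0) (4 * m).+1.
  rewrite v0; apply: has_degree_lt (degree_affine_row (c i1) h0 h1 h2 lt_rm r0 (row_neq0 i1)) _.
  by case: ifP => _; [|case: ifP => _]; lia.
(* The exceptional, triangular case: the last two components of v have degrees m and r, so the first
   one and Q^2 (Q - R^2)^2 may both have degree 4 m and cancel. *)
have [|] := boolP [&& M i0 i1 == 0, M i0 i0 != 0, M i2 i1 == 0 & M i2 i0 == 0]; last first.
  move=> nbad; apply/dominated_untwist2/(dominated_untwist d0 d1 d2).
    by case: ifP => _; [|case: ifP => _]; lia.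
  have := unitmx3_block uM; move: nbad.
  rewrite -[M i0 i1 == 0]negbK -[M i2 i1 == 0]negbK -[M i2 i0 == 0]negbK.
  by case: (M i0 i1 != 0); case: (M i0 i0 != 0); case: (M i2 i1 != 0);
     case: (M i2 i0 != 0) => //= _ _; lia.
case/and4P=> /eqP M01 M00 /eqP M21 /eqP M20 {d0 d1 d2}.
have M22 : M i2 i2 != 0 by have := row_neq0 i2; rewrite M20 M21 eqxx.
(* The first degree may equal the second here; one further [untwist] restores domination. *)
have big w p q k : (k <= q)%N -> (0 < k)%N -> (3 * p < k)%N -> (0 < p)%N ->
    has_degree (tnth w i0) k -> has_degree (tnth w i1) q -> has_degree (tnth w i2) p ->
    dominated (untwist w).
  move=> kq k0 pk p0 w0 w1 w2.
  by apply: (dominated_untwist (has_degree_lt w0 _) w1 w2 p0); [exact: leqnn|lia].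
have [q [p [hP hQ hR [lt_pq p0]]]] := ds.
have := degrees_untwist_triangular two_neq0 (M i0 i2) (c i0) (c i2) (M i1 i1) (M i1 i0) (M i1 i2) (c i1)
  hP hQ hR lt_pq p0 M00 M22.
have eqW : tnth v i1 = (M i0 i0)%:MP * (tnth s i1 + tnth s i2 ^+ 2) +
    (M i0 i2)%:MP * tnth s i2 + (c i0)%:MP.
  by rewrite v1 M01 /u /twist !tnth3E; ring.
have eqS : tnth v i2 = (M i2 i2)%:MP * tnth s i2 + (c i2)%:MP.
  by rewrite v2 M20 M21 /u /twist !tnth3E; ring.
have eqV : tnth v i0 = (M i1 i1)%:MP *
      (tnth s i0 + tnth s i1 ^+ 2 * (tnth s i1 + tnth s i2 ^+ 2) ^+ 2) +
    (M i1 i0)%:MP * (tnth s i1 + tnth s i2 ^+ 2) + (M i1 i2)%:MP * tnth s i2 + (c i1)%:MP.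
  by rewrite v0 /u /twist !tnth3E; ring.
rewrite -eqW -eqS -eqV => -[g0 g2 [[j g1 [le_qj _]]|]].
  by apply: (big _ p j q); rewrite /untwist ?tnth3E //; lia.
case=> Ma Md Mb Mk [Mk3 Me].
(* With c the entry [M i2 i2], a is now (c^2 x, c^8 y + z-term + constant, c z). The inner beta pair
   cancels, and the same analysis applies one level down, to [t], with the roles of x and y
   exchanged. *)
have Md0 : M i1 i1 != 0 by rewrite Md expf_neq0.
have [q' [r' [hP' hQ' hR' [lt_rq' r0']]]] := dt.
have := degrees_untwist_triangular two_neq0 (M i1 i2) (c i1) 0 (M i0 i0) 0 0 0
  hP' hQ' hR' lt_rq' r0' Md0 M22.
have eqS' : tnth (untwist v) i2 = (M i2 i2)%:MP * tnth t i2 + 0%:MP.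
  by rewrite /untwist tnth3E eqS Mk3 /s /twist tnth3E.
have eqV' : tnth (untwist v) i0 = (M i0 i0)%:MP *
      (tnth t i0 + tnth t i1 ^+ 2 * (tnth t i1 + tnth t i2 ^+ 2) ^+ 2) +
    0%:MP * (tnth t i1 + tnth t i2 ^+ 2) + 0%:MP * tnth t i2 + 0%:MP.
  rewrite /untwist tnth3E eqW eqS Mk3 Mb Mk Ma /s /twist !tnth3E; ring.
have eqW' : tnth (untwist v) i1 = (M i1 i1)%:MP * (tnth t i1 + tnth t i2 ^+ 2) +
    (M i1 i2)%:MP * tnth t i2 + (c i1)%:MP.
  rewrite /untwist tnth3E eqW eqS eqV Mk3 Mb Mk Ma Me Md /s /twist !tnth3E; ring.
(* No [untwist] remains to repair equal degrees, so the strict bound available for e = 0 is used. *)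
rewrite -eqW' -eqS' -eqV' => -[g0' g2' [[j g1' [_ /(_ erefl) lt_qj]]|]].
  exists j, r'; split; [exact: has_degree_lt g0' lt_qj|exact: g1'|exact: g2'|].
  by split=> //; apply: ltn_trans lt_qj.
(* The entry [M i0 i0] equals c^2 by the first level and c^8 by the second. *)
case=> Md' Ma' Mz Mk1 _; case/negP: ndiag.
have cM : (tnth (aut a) i2)@_U_(i2) = M i2 i2 by rewrite E affine_comp_coeff.
have aE i : tnth (aut a) i = (M i i0)%:MP * varX K + (M i i1)%:MP * varY K +
    (M i i2)%:MP * varZ K + (c i)%:MP.
  by rewrite -[aut a]endo_mul1 (affine_endo_mul _ _ E) !tnth_mktuple.
rewrite /stable_diagonal cM -Ma' Ma eqxx /=; apply/eqP/endo3_eq; rewrite aE tnth3E.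
- by rewrite M01 Mb Mk Ma; ring.
- by rewrite Me Md' Mz Mk1; ring.
- by rewrite M20 M21 Mk3; ring.
Qed.

(** * Normal forms in the group generated by theta_2 and the affine maps *)

Inductive reduced : GA 3 K -> Prop :=
| reduced1 a of affine_map a : reduced (theta2 K * a)%g
| reducedM a g of affine_map a & ~~ stable_diagonal a & reduced g : reduced (theta2 K * a * g)%g.

Lemma reduced_twist g : reduced g -> exists2 t, dominated t & aut g = twist (twist t).
Proof.
elim=> [a aff|a h aff ndiag _ [t dt eq_h]].
  exists (untwist (untwist (swap (aut a)))); last exact: endo_mul_theta2.
  have d i := affine_map_degree i aff.
  (* All components of an affine map have degree 1, so R^2 dominates Q; the 2 is the strict bound on
     P. *)
  apply/dominated_untwist2/(@dominated_untwist _ 2 1 1); rewrite /swap ?tnth3E //; last lia.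
  exact: has_degree_lt (d i1) _.
exists (untwist (untwist (swap (endo_mul (aut a) (twist (twist t)))))).
  exact: dominated_affine.
by rewrite -[LHS]endo_mul1 (endo_mul_autM (_ * a)%g) (endo_mul_autM _ a) endo_mul1 eq_h
   endo_mul_theta2.
Qed.

Definition amalgam (g : GA 3 K) :=
  affine_map g \/ exists a h, [/\ affine_map a, reduced h & g = (a * h)%g].

Lemma amalgam_affine a g : affine_map a -> amalgam g -> amalgam (a * g)%g.
Proof.
move=> aff [aff_g|[b [h [aff_b red_h ->]]]]; first by left; apply: affine_mapM.
by right; exists (a * b)%g, h; rewrite mulgA; split=> //; apply: affine_mapM.
Qed.

Lemma reduced_theta2 h : reduced h -> amalgam (theta2 K * h)%g.
Proof.
case=> [a aff|a g aff _ red_g]; first by left; rewrite theta2K.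
right; exists a, g; split=> //.
by rewrite -[(theta2 K * a * g)%g](mulgA (theta2 K) a g) theta2K.
Qed.

(** If a is not a [stable_diagonal], the word grows; otherwise theta_2 moves past a and cancels the
    first letter of h. *)
Lemma amalgam_theta2 g : amalgam g -> amalgam (theta2 K * g)%g.
Proof.
case=> [aff|[a [h [aff red_h ->]]]].
  right; exists 1%g, (theta2 K * g)%g; rewrite mul1g; split=> //.
    exact: affine_map1.
  exact: reduced1.
have [diag_a|ndiag] := boolP (stable_diagonal a); last first.
  right; exists 1%g, (theta2 K * a * h)%g; rewrite mul1g mulgA; split=> //.
    exact: affine_map1.
  exact: reducedM.
rewrite mulgA stable_diagonal_commute // -mulgA.
exact/amalgam_affine/reduced_theta2.
Qed.

Lemma gen_subgroup_amalgam g :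
  gen_subgroup (fun rho : GA 3 K => rho = theta2 K \/ is_affine rho) g -> amalgam g.
Proof.
have thetaV : ((theta2 K)^-1 = theta2 K)%g.
  by rewrite -[LHS]mulg1 -theta2_invol mulKg.
move=> gen_g; rewrite -[g]mulg1.
(* Stability under g and g^-1 is proved together, so that the inverse case of the induction just
   exchanges the two. *)
suff [] : (forall h, amalgam h -> amalgam (g * h)%g) /\
          (forall h, amalgam h -> amalgam (g^-1 * h)%g).
  by move=> mul_g _; apply: mul_g; left; apply: affine_map1.
elim: gen_g => {g} [g [->|/is_affine_map aff]||g h _ [IHg IHgV] _ [IHh IHhV]|g _ [IHg IHgV]].
- by rewrite thetaV; split=> h; apply: amalgam_theta2.
- by split=> h; [apply: amalgam_affine aff|apply: amalgam_affine (affine_mapV aff)].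
- by split=> h; rewrite ?invg1 mul1g.
- split=> k amk; rewrite ?invgM -mulgA; first exact/IHg/IHh.
  exact/IHhV/IHgV.
- by rewrite invgK; split; [exact: IHgV|exact: IHg].
Qed.

(** * A tame quadratic map outside the group *)

Definition shear (e : K) : endo 3 K :=
  [tuple varX K; varY K + e%:MP * varX K ^+ 2; varZ K].

Lemma shearK e : endo_mul (shear e) (shear (- e)) = endo1 3 K.
Proof.
apply: endo3_eq; rewrite !tnth_mktuple /shear !tnth3E ?compE //.
by rewrite rmorphD rmorphM rmorphXn /= !compE !tnth3E mpolyCN mulNr subrK.
Qed.

Fact shear_subproof : mutually_inverse (shear 1, shear (- 1)).
Proof. by rewrite /mutually_inverse /= shearK -{2}[1]opprK shearK eqxx. Qed.

Definition shear_aut : GA 3 K := MkGA shear_subproof.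

Lemma shear_tame : is_tame shear_aut.
Proof.
apply: gen_subgroup_mem; right; exists 1, 1, 1, 0, ('X_ord0 ^+ 2), 0.
split; rewrite ?oner_eq0 //; apply: endo3_eq; rewrite -[aut _]/(shear 1) /shear !tnth3E.
- by rewrite scale1r mpolyC0 addr0.
- by rewrite scale1r mpolyC1 mul1r rmorphXn /= comp_mpolyXU.
- by rewrite scale1r comp_mpoly0 addr0.
Qed.

Lemma shear_not_amalgam : ~ amalgam shear_aut.
Proof.
have hX : has_degree (varX K ^+ 2) 2.
  by apply: (@has_degreeX2 _ _ _ 1); rewrite /has_degree msizeX mdeg1.
have lin i : degree_lt ('X_i : {mpoly K[3]}) 2 by rewrite /degree_lt msizeX mdeg1.
have hY : has_degree (varY K + 1%:MP * varX K ^+ 2) 2.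
  by apply: has_degreeDr; [apply: lin|rewrite mpolyC1 mul1r].
case=> [aff|[a [h [aff red_h defh]]]].
  by have := affine_map_degree i1 aff; rewrite /has_degree hY.
have {defh} : (a^-1 * shear_aut = h)%g by rewrite defh mulKg.
have [M _ [c E]] := affine_mapV aff => defh.
have [t /dominated_twist/twist_degrees[q [r [_ ht _ [lt_rq r0]]]] eqh] := reduced_twist red_h.
(* The reduced word has second component of degree 4 q with q > 3 r >= 3, so at least 16, whereas an
   affine map times the shear has degree at most 2. *)
suff : degree_lt (tnth (aut h) i1) 3.
  by rewrite eqh /degree_lt ht; lia.
rewrite -defh -[aut _]endo_mul1 endo_mul_autM endo_mul1 (affine_endo_mul _ _ E).
have d i : degree_lt (tnth (shear 1) i) 3.
  case: (ord3P i) => ->; rewrite /shear tnth3E.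
  - exact: degree_ltW (lin _) _.
  - exact: has_degree_lt hY _.
  - exact: degree_ltW (lin _) _.
by do !apply: degree_ltD; try exact/degree_ltCM/d; apply: degree_ltC.
Qed.
End DimensionThree.

Theorem theorem25 (K : fieldType) (charK0 : [pchar K] =i pred0) :
  ~ co_tame (theta2 K).
Proof.
have two_neq0 : (2%:R : K) != 0.
  by have := charK0 2%N; rewrite !inE /= => ->.
by move=> /(_ _ (shear_tame K))/gen_subgroup_amalgam/(shear_not_amalgam two_neq0).
Qed.
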